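(* Let $A:X=\ell^2\to Y$, $y$, $x^\dagger$ and $\mathcal R$ satisfy the following. (1) $A$ is an injective bounded linear operator from $\ell^2$ to the infinite dimensional Banach space $Y$ with adjoint $A^*:Y^*\to \ell^2$, and the range of $A$ is not closed in $Y$. We have $y\in{\rm Range}(A)$, and the unique solution $x^\dagger$ of $Ax=y$ lies in $\ell^0$, with non-empty finite support $I=\{i\in\mathbb N: x_i^\dagger\ne 0\}$. The functional $\mathcal R:\ell^2\to[0,\infty]$ is proper, convex, lower semi-continuous and stabilizing, i.e. all sublevel sets $\{x\in \ell^2:\mathcal R(x)\le c\}$, $c\ge 0$, are weakly sequentially pre-compact in $\ell^2$. (2) For every $i\in\mathbb N$ there exists $\omega_i\in Y^*$ with $e^{(i)}=A^*\omega_i$. (3) $x^\dagger\in\mathcal D(\mathcal R)$, $\partial\mathcal R(x^\dagger)\neq\emptyset$, and there exist $\xi^\dagger\in\partial\mathcal R(x^\dagger)$ and $w\in Y^*$ with $\xi^\dagger=A^*w$. Let $1<q<\infty$ and, for data $y^\delta\in Y$ with $\|y-y^\delta\|\le\delta$ and $\alpha>0$, let $x_\alpha^\delta$ denote a minimizer over $x\in\ell^2$ of $$\Phi_\alpha^\delta(x)=\frac1q\|Ax-y^\delta\|^q+\alpha\,\Omega(x),\qquad \Omega(x)=\|x\|_{\ell^0}+\mathcal R(x).$$ Then the linear convergence rate $$\|x_{\alpha_*}^\delta-x^\dagger\|_{\ell^1}=\mathcal O(\delta)\quad\text{as}\quad\delta\to0$$ holds true whenever the regularization parameter $\alpha_*>0$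 is chosen either a priori as $\alpha_*=\alpha_*(\delta)\sim\delta^{q-1}$ or a posteriori as $\alpha_*=\alpha_*(\delta,y^\delta)$ by the sequential discrepancy principle.
   Context: $\ell^0$ is the set of real sequences with finitely many nonzero components. For a sequence $x$, $\|x\|_{\ell^0}=\sum_{i=1}^\infty \operatorname{sgn}(|x_i|)$ is the number of its nonzero components ($+\infty$ if $x\notin\ell^0$). $e^{(i)}$ is the $i$-th standard unit sequence in $\ell^2$. $\|\cdot\|$ is the norm of $Y$, and $Y^*$ is the dual of $Y$. The dual of $\ell^2$ is identified with $\ell^2$, so that $\langle A^*w,x\rangle=\langle w,Ax\rangle_{Y^*\times Y}$. $\mathcal D(\mathcal R)=\{x\in\ell^2:\mathcal R(x)<\infty\}$, and $\partial\mathcal R(x)\subseteq\ell^2$ is the convex subdifferential of $\mathcal R$ at $x$. Sequential discrepancy principle: for sufficiently large $\alpha_0>0$ and prescribed constants $0<\nu<1$, $\tau>1$, let $\alpha_j=\nu^j\alpha_0$ and $\Delta_\nu=\{\alpha_j: j=1,2,\dots\}$. The parameter $\alpha_*=\alpha_{j_*}\in\Delta_\nu$ is chosen according to the principle if $$\|Ax_{\alpha_{j_*}}^\delta-y^\delta\|\le\tau\delta<\|Ax_{\alpha_{j_*-1}}^\delta-y^\delta\|.$$ *)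

(* Defs.v *)
(* Sequences are indexed from 0. *)
From HB Require Import structures.
From mathcomp Require Import all_boot all_order all_algebra.
From mathcomp Require Import all_classical all_reals all_analysis.
From mathcomp Require Import ring lra.

Set Implicit Arguments.
Unset Strict Implicit.
Unset Printing Implicit Defensive.
Import Order.TTheory GRing.Theory Num.Theory.
Import numFieldNormedType.Exports.

Local Open Scope classical_set_scope.
Local Open Scope ring_scope.

Section Ell2.
Context (R : realType).
Implicit Types x y : nat -> R^o.

Definition sq_summable : {pred nat -> R^o} :=
  fun x => `[< cvgn (series (fun i => (x i : R) ^+ 2)) >].

Lemma sq_summable_mul x y : x \in sq_summable -> y \in sq_summable ->
  cvgn (series (fun i => (x i : R) * y i)).
Proof.
move=> /asboolP xl /asboolP yl; apply: normed_cvg.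
apply: (@series_le_cvg _ _ (fun i => (x i : R) ^+ 2 + (y i : R) ^+ 2)) => //=.
- by move=> i; rewrite addr_ge0 ?sqr_ge0.
- move=> i; rewrite normrM -(real_normK (num_real (x i))).
  rewrite -(real_normK (num_real (y i))).
  have := normr_ge0 (x i : R); have := normr_ge0 (y i : R).
  set a := `|_|; set b := `|_| => a0 b0.
  by have := sqr_ge0 (a - b); nra.
- by have := is_cvg_seriesD xl yl.
Qed.

Lemma sq_summable_submod : submod_closed sq_summable.
Proof.
split.
  apply/asboolP; rewrite (_ : series _ = cst 0); last first.
    by apply/funext => n; rewrite /series/= big1// => i _; rewrite expr0n.
  exact: is_cvg_cst.
move=> a x y xl yl; apply/asboolP.
have xy := @is_cvg_seriesZ R _ a (sq_summable_mul xl yl).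
move: xl yl => /asboolP xl /asboolP yl.
have xx := @is_cvg_seriesZ R _ (a ^+ 2) xl.
have := is_cvg_seriesD xx (is_cvg_seriesD (is_cvg_seriesD xy xy) yl).
set f := (X in series X) => fl; set g := (X in series X).
suff -> : g = f by [].
by apply/funext => i; rewrite /f /g !fctE /GRing.scale /=; ring.
Qed.

HB.instance Definition _ :=
  GRing.isSubmodClosed.Build R (nat -> R^o) sq_summable sq_summable_submod.

Record ell2 := Ell2 { ell2_val :> nat -> R^o; _ : ell2_val \in sq_summable }.

HB.instance Definition _ := [isSub for ell2_val].
HB.instance Definition _ := [Choice of ell2 by <:].
HB.instance Definition _ := [SubChoice_isSubLmodule of ell2 by <:].

Implicit Types u v w : ell2.

Definition dot u v : R := limn (series (fun i => (u i : R) * v i)).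

Lemma dot_cvg u v : cvgn (series (fun i => (u i : R) * v i)).
Proof. exact: sq_summable_mul (valP u) (valP v). Qed.

Lemma dotC u v : dot u v = dot v u.
Proof. by rewrite /dot; congr (limn (series _)); apply/funext => i; rewrite mulrC. Qed.

Lemma dotDl u v w : dot (u + v) w = dot u w + dot v w.
Proof.
rewrite /dot -lim_seriesD; [|exact: dot_cvg..].
by congr (limn (series _)); apply/funext => i /=; rewrite -mulrDl.
Qed.

Lemma dotZl a u v : dot (a *: u) v = a * dot u v.
Proof.
rewrite /dot -[RHS](@lim_seriesZ R _ a (@dot_cvg u v)).
by congr (limn (series _)); apply/funext => i /=; rewrite -mulrA.
Qed.

Lemma dot0l v : dot 0 v = 0.
Proof. by rewrite -(scale0r v) dotZl mul0r. Qed.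

Lemma dot_ge0 u : 0 <= dot u u.
Proof.
apply: limr_ge; first exact: dot_cvg.
by near=> n; rewrite /series/= sumr_ge0// => i _; rewrite -expr2 sqr_ge0.
Unshelve. all: by end_near.
Qed.

Lemma dot_eq0 u : dot u u = 0 -> u = 0.
Proof.
move=> u0; apply/val_inj/funext => i; apply/eqP.
have mono : nondecreasing_seq (series (fun i => (u i : R) * u i)).
  by apply/nondecreasing_seqP => n; rewrite seriesSr lerDl -expr2 sqr_ge0.
have := nondecreasing_cvgn_le mono (@dot_cvg u u) i.+1.
rewrite -/(dot u u) u0 seriesSr => h.
have /eqP : (u i : R) ^+ 2 = 0.
  apply/eqP; rewrite eq_le sqr_ge0 andbT expr2 (le_trans _ h)// lerDr.
  by rewrite /series/= sumr_ge0// => k _; rewrite -expr2 sqr_ge0.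
by rewrite sqrf_eq0.
Qed.

Definition ell2_norm u : R := Num.sqrt (dot u u).

Lemma dot_le u v : dot u v <= ell2_norm u * ell2_norm v.
Proof.
pose a := ell2_norm u; pose b := ell2_norm v.
have a0 : 0 <= a by exact: sqrtr_ge0.
have b0 : 0 <= b by exact: sqrtr_ge0.
have aE : dot u u = a ^+ 2 by rewrite sqr_sqrtr// dot_ge0.
have bE : dot v v = b ^+ 2 by rewrite sqr_sqrtr// dot_ge0.
have : 0 <= dot (b *: u + (- a) *: v) (b *: u + (- a) *: v) by exact: dot_ge0.
rewrite dotDl !dotZl ![dot _ (_ + _)]dotC !dotDl !dotZl (dotC v u) aE bE => h.
rewrite -/a -/b; move: a0; rewrite le_eqVlt => /predU1P[a0|a0].
  have -> : u = 0 by apply: dot_eq0; rewrite aE -a0 expr0n.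
  by rewrite dot0l mulr_ge0 ?sqrtr_ge0.
move: b0; rewrite le_eqVlt => /predU1P[b0|b0].
  have -> : v = 0 by apply: dot_eq0; rewrite bE -b0 expr0n.
  by rewrite dotC dot0l mulr_ge0 ?sqrtr_ge0.
by move: (mulr_gt0 a0 b0) => ab0; nra.
Qed.

Lemma ell2_normD u v : ell2_norm (u + v) <= ell2_norm u + ell2_norm v.
Proof.
rewrite -(@ler_pXn2r _ 2)// ?nnegrE ?addr_ge0 ?sqrtr_ge0//.
rewrite sqrrD !sqr_sqrtr ?dot_ge0// dotDl ![dot _ (_ + _)]dotC !dotDl (dotC v u).
rewrite mulr2n !addrA lerD2r -!addrA lerD2l.
by rewrite lerD// dot_le.
Qed.

Lemma ell2_normZ a u : ell2_norm (a *: u) = `|a| * ell2_norm u.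
Proof.
by rewrite /ell2_norm dotZl dotC dotZl mulrA -expr2 sqrtrM ?sqr_ge0// sqrtr_sqr.
Qed.

Lemma ell2_norm_eq0 u : ell2_norm u = 0 -> u = 0.
Proof.
move=> /eqP; rewrite sqrtr_eq0 => u0; apply: dot_eq0; apply/eqP.
by rewrite eq_le u0 dot_ge0.
Qed.

HB.instance Definition _ := Lmodule_isNormed.Build R ell2
  ell2_normD ell2_normZ ell2_norm_eq0.

Lemma unit_seq_subproof (i : nat) :
  (fun j => (j == i)%:R : R^o) \in sq_summable.
Proof.
apply/asboolP; apply: (is_cvg_near_cst (1 : R)).
near=> n; have ni : (i < n)%N by near: n; exact: nbhs_infty_gt.
rewrite /series/= big_mkord (bigD1 (Ordinal ni))//= eqxx expr1n big1 ?addr0//.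
by move=> j; rewrite -val_eqE /= => /negbTE ->; rewrite expr0n.
Unshelve. all: by end_near.
Qed.

Definition unit_seq (i : nat) : ell2 := Ell2 (unit_seq_subproof i).

Definition supp (x : nat -> R) : set nat := [set i | x i != 0].

Definition ell0_norm (x : nat -> R) : \bar R :=
  (\sum_(0 <= i <oo) (Num.sg `|x i|)%:E)%E.

Definition ell1_norm (x : nat -> R) : \bar R :=
  (\sum_(0 <= i <oo) `|x i|%:E)%E.

End Ell2.

Section FunctionalAnalysis.
Context (R : realType).

Definition bounded_op (V W : normedModType R) (A : V -> W) :=
  exists M : R, forall x, `|A x| <= M * `|x|.

Definition finite_dimensional (V : lmodType R) :=
  exists n (b : 'I_n -> V), forall v, exists c : 'I_n -> R,
    v = \sum_(i < n) c i *: b i.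

Record topdual (V : normedModType R) := Dual {
  topdual_val :> {linear V -> R^o};
  topdual_continuous : continuous topdual_val }.

Definition weakly_cvg (V : normedModType R) (u : nat -> V) (x : V) :=
  forall w : topdual V, (fun n => w (u n)) @ \oo --> w x.

(* The weak limit need not belong to S. *)
Definition weakly_seq_precompact (V : normedModType R) (S : set V) :=
  forall u : nat -> V, (forall n, S (u n)) ->
  exists2 s : nat -> nat, increasing_seq s &
  exists x, weakly_cvg (u \o s) x.

Definition is_adjoint (Y : normedModType R) (A : ell2 R -> Y)
    (Astar : topdual Y -> ell2 R) :=
  forall (w : topdual Y) (x : ell2 R), dot (Astar w) x = w (A x).

Local Open Scope ereal_scope.

Definition edom (V : Type) (f : V -> \bar R) : set V := [set x | f x < +oo].

(* Properness of functionals that do not take the value -oo. *)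
Definition eproper (V : Type) (f : V -> \bar R) := edom f !=set0.

Definition econvex (V : lmodType R) (f : V -> \bar R) :=
  forall (x z : V) (t : R), (0 <= t <= 1)%R ->
    f (t *: x + (1 - t) *: z)%R <= t%:E * f x + (1 - t)%:E * f z.

Definition stabilizing (V : normedModType R) (f : V -> \bar R) :=
  forall c : R, (0 <= c)%R -> weakly_seq_precompact [set x | f x <= c%:E].

Definition subdifferential (f : ell2 R -> \bar R) (x : ell2 R) : set (ell2 R) :=
  [set xi | forall z, f x + (dot xi (z - x)%R)%:E <= f z].

Definition argmin (V : Type) (f : V -> \bar R) : set V :=
  [set x | forall z, f x <= f z].

End FunctionalAnalysis.

Section Tikhonov.
Context (R : realType) (Y : normedModType R).
Variables (A : ell2 R -> Y) (Reg : ell2 R -> \bar R).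

Definition Omega (x : ell2 R) : \bar R := (ell0_norm x + Reg x)%E.

Definition Phi (q : R) (yd : Y) (a : R) (x : ell2 R) : \bar R :=
  ((q^-1 * `|A x - yd| `^ q)%:E + a%:E * Omega x)%E.

Definition minimizers (q : R) (yd : Y) (x : R -> ell2 R) :=
  forall a, 0 < a -> argmin (Phi q yd a) (x a).

(* The selected exponent is j.+1, so that it ranges over 1, 2, ... *)
Definition discrepancy_choice (nu tau alpha0 d : R) (yd : Y)
    (x : R -> ell2 R) (a : R) :=
  exists j : nat, [/\ a = nu ^+ j.+1 * alpha0,
    `|A (x a) - yd| <= tau * d &
    tau * d < `|A (x (nu ^+ j * alpha0)) - yd|].

End Tikhonov.

(* Main.v *)
Require Import Defs.
From HB Require Import structures.
From mathcomp Require Import all_boot all_order all_algebra.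
From mathcomp Require Import all_classical all_reals all_analysis.
From mathcomp Require Import finmap ring lra.

Set Implicit Arguments.
Unset Strict Implicit.
Unset Printing Implicit Defensive.
Import Order.TTheory GRing.Theory Num.Theory.
Import numFieldNormedType.Exports.

Local Open Scope classical_set_scope.
Local Open Scope ring_scope.

(** The penalty [ell0_norm] is integer valued, and this turns an approximate
    solution into an exact identification of the support.  Every unit sequence
    is in the range of the adjoint, so each coordinate obeys
    |x_i| <= M_i |A x|.  Two consequences:
    - if |A (x - xdag)| is below a threshold, every coordinate in the support
      I of xdag stays nonzero in x ([supp_stable]), so x has at least as many
      nonzero components as xdag;
    - if moreover x vanishes off I, only the finitely many coordinates of I
      contribute to the error, and its ell1 norm is at most
      (sum over I of M_i) |A (x - xdag)| ([ell1_error_le]).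
    It remains to exclude nonzero components of x off I.  One such component
    costs a full unit of penalty.  The source condition gives
    Reg xdag - Reg x <= W |A (x - xdag)|, which can recover only O(d), and
    minimality allows Omega x to exceed Omega xdag by at most d^q / (q a).
    Hence the supports agree as soon as |A (x - xdag)| = O(d) and
    d^q / a = O(d) ([ell1_rate]), and the rate follows.

    Both conditions are then checked for each parameter choice.
    - For a = O(d^(q-1)), minimality first makes the residual T = |A x - yd|
      small, whence I is contained in the support of x and
      T^q <= d^q + q a W (T + d); since q > 1, this forces T = O(d)
      ([residual_rate]).  The lower bound on the a priori parameter is the
      bound on d^q / a.
    - The discrepancy principle bounds the residual at the chosen a by tau d.
      At the preceding parameter b = a / nu the residual exceeds tau d, so
      minimality gives (tau^q - 1) d^q <= q b (Omega xdag - Omega x_b), and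
      the last factor is O(d) when b <= d^(q-1), while d^q / b < d otherwise
      ([discrepancy_lower_bound]). *)

(** * Functionals and finitely supported series *)

Lemma topdual_bound (R : realType) (V : normedModType R) (w : topdual V) :
  exists2 M : R, 0 <= M & forall v : V, `|(w v : R)| <= M * `|v|.
Proof.
have /linear_boundedP wb := continuous_linear_bounded (0 : V)
  (@topdual_continuous _ _ w 0).
near +oo_R => M; exists M => [|v].
  by near: M; exact: nbhs_pinfty_ge.
by move: v; near: M.
Unshelve. all: by end_near. Qed.

Lemma ell2_valB (R : realType) (x z : ell2 R) i : (x - z) i = (x i : R) - z i.
Proof. by []. Qed.

Lemma dot_unit_seq (R : realType) (x : ell2 R) i : dot (unit_seq R i) x = x i.
Proof.
apply: cvg_lim => //; apply: cvg_near_cst; near=> n.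
have ni : (i < n)%N by near: n; exact: nbhs_infty_gt.
rewrite /series/= big_mkord (bigD1 (Ordinal ni))//= eqxx mul1r big1 ?addr0//.
by move=> j; rewrite -val_eqE /= => /negbTE ->; rewrite mul0r.
Unshelve. all: by end_near. Qed.

Lemma eseries_fin_supp (R : realType) (F : {fset nat}) (f : nat -> \bar R) :
  (forall i, (0 <= f i)%E) -> (forall i, i \notin F -> f i = 0%E) ->
  (\sum_(0 <= i <oo) f i = \sum_(i <- F) f i)%E.
Proof.
move=> f0 fF; rewrite nneseries_esumT//.
transitivity (\esum_(i in [set` F]) f i)%E.
  rewrite [RHS]esum_mkcond; apply: eq_esum => i _.
  by case: ifPn => //; rewrite notin_setE => iF; apply: fF; exact/negP.
rewrite esum_fset//.
by rewrite fsbig_finite//= set_fsetK.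
Qed.

(** * The number of nonzero components *)

Section Counting.
Context (R : realType).
Implicit Types x z : nat -> R.

Lemma sg_norm_supp x i : Num.sg `|x i| = (x i != 0)%:R.
Proof.
case: (eqVneq (x i) 0) => [->|xi0]; first by rewrite normr0 sgr0.
by rewrite gtr0_sg ?normr_gt0.
Qed.

Lemma ell0_norm_ge0 x : (0 <= ell0_norm x)%E.
Proof. by apply: nneseries_ge0 => i _ _; rewrite lee_fin sg_norm_supp ler0n. Qed.

Lemma ell0_norm_fin x : finite_set (supp x) -> ell0_norm x \is a fin_num.
Proof.
move=> fx; rewrite /ell0_norm (@eseries_fin_supp _ (fset_set (supp x))).
- by rewrite sumEFin.
- by move=> i; rewrite lee_fin sg_norm_supp ler0n.
- move=> i; rewrite in_fset_set// notin_setE /supp/= => /negP.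
  by rewrite negbK => /eqP ->; rewrite normr0 sgr0.
Qed.

Lemma ell0_norm_le x z : supp x `<=` supp z -> (ell0_norm x <= ell0_norm z)%E.
Proof.
move=> xz; apply: lee_nneseries => i _; first by rewrite lee_fin sg_norm_supp ler0n.
rewrite lee_fin !sg_norm_supp ler_nat.
by have := xz i; rewrite /supp/=; case: (x i != 0) => // /(_ isT) ->.
Qed.

(** Termwise, the indicator of supp x plus the indicator of j is at most the
    indicator of supp z.  Since this holds in the extended reals, it also
    covers sequences z with infinite support. *)
Lemma ell0_normD1_le x z j : supp x `<=` supp z -> (supp z `\` supp x) j ->
  (ell0_norm x + 1 <= ell0_norm z)%E.
Proof.
move=> xz [zj xj].
have d1 : (\sum_(0 <= i <oo) ((i == j)%:R : R)%:E = 1)%E.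
  rewrite (@eseries_fin_supp _ [fset j]%fset).
  - by rewrite big_seq_fset1 eqxx.
  - by move=> i; rewrite lee_fin ler0n.
  - by move=> i; rewrite inE => /negbTE ->.
rewrite -d1 -nneseriesD; [|by move=> i *; rewrite lee_fin ?sg_norm_supp ler0n..].
apply: lee_nneseries => i _; first by rewrite -EFinD lee_fin sg_norm_supp -natrD ler0n.
rewrite -EFinD lee_fin !sg_norm_supp -natrD ler_nat.
have := xz i; rewrite /supp/=; case: (eqVneq i j) => [->|_].
  by move: zj xj; rewrite /supp/= => -> /negP; rewrite negbK => /eqP ->; rewrite eqxx.
by case: (x i != 0) => // /(_ isT) ->.
Qed.

End Counting.

(** * Powers of the noise level *)

(** For T > d the right-hand side is at most (1 + 2 c) T d^(q-1), and one power
    of T cancels.  The base 1 + 2 c >= 1 makes the constant at least 1, which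
    takes care of T <= d. *)
Lemma powR_absorb (R : realType) (q c T d : R) :
  1 < q -> 0 <= c -> 0 <= T -> 0 < d ->
  T `^ q <= d `^ q + c * d `^ (q - 1) * (T + d) ->
  T <= (1 + 2 * c) `^ (q - 1)^-1 * d.
Proof.
move=> q1 c0 T0 d0 h; have q0 : 0 < q by lra.
have q10 : 0 < q - 1 by lra.
have d1 : 0 < d `^ (q - 1) by exact: powR_gt0.
have B1 : 1 <= (1 + 2 * c) `^ (q - 1)^-1.
  rewrite -[leLHS](powRr0 (1 + 2 * c)); apply: ler_powR; first lra.
  by rewrite invr_ge0; lra.
case: (leP T d) => [Td|dT]; first by rewrite (le_trans Td)// ler_peMl// ltW.
have Tp : 0 < T := lt_trans d0 dT.
have {}h : T `^ (q - 1) <= (1 + 2 * c) * d `^ (q - 1).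
  rewrite -(@ler_pM2l _ T)//.
  rewrite mulr_powRB1// (le_trans h)// -(@mulr_powRB1 _ d)//; last exact: ltW.
  set P := d `^ _ in d1 *.
  by have := mulr_ge0 c0 (ltW d1); nra.
have := @ge0_ler_powR _ (q - 1)^-1 _ _ _ _ _ h.
rewrite !nnegrE powR_ge0 mulr_ge0 ?powR_ge0 ?invr_ge0 ?(ltW q10)//; last lra.
rewrite powRM ?powR_ge0//; last lra.
rewrite -!powRrM divff ?gt_eqF// !powRr1//; last exact: ltW.
exact.
Qed.

(** * Minimizers of the Tikhonov functional *)

Section Tikhonov.
Context (R : realType) (Y : normedModType R) (A : {linear ell2 R -> Y}).
Context (Reg : ell2 R -> \bar R) (xdag : ell2 R).
Context (q : R) (q_gt1 : 1 < q).
Context (xdag_ell0 : finite_set (supp xdag)).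
Context (Reg_ge0 : forall x, (0 <= Reg x)%E) (xdag_dom : edom Reg xdag).
(* The range conditions on the adjoint enter only through coord_le and
   Reg_source: images under A control the coordinates and the decrease of Reg. *)
Context (M : nat -> R) (M_ge0 : forall i, 0 <= M i).
Context (coord_le : forall i (x : ell2 R), `|(x i : R)| <= M i * `|A x|).
Context (W : R) (W_ge0 : 0 <= W).
Context (Reg_source : forall x, (Reg xdag <= Reg x + (W * `|A (x - xdag)|)%:E)%E).

Let I := fset_set (supp xdag).
Let K := \sum_(i <- I) M i.
Local Notation om x := (fine (Omega Reg x)).

Lemma mem_supp_xdag i : (i \in I) = ((xdag i : R) != 0).
Proof. by rewrite in_fset_set//; apply/idP/idP => [/set_mem|/mem_set]. Qed.

Lemma Omega_ge0 x : (0 <= Omega Reg x)%E.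
Proof. by rewrite adde_ge0// ell0_norm_ge0. Qed.

Lemma Reg_xdag_fin : Reg xdag \is a fin_num.
Proof. by rewrite ge0_fin_numE. Qed.

Lemma Omega_xdag_fin : Omega Reg xdag \is a fin_num.
Proof. by rewrite fin_numD ell0_norm_fin// Reg_xdag_fin. Qed.

Lemma om_ge0 x : 0 <= om x.
Proof. exact/fine_ge0/Omega_ge0. Qed.

Lemma sum_M_ge0 : 0 <= K.
Proof. exact: sumr_ge0. Qed.

Lemma M_le_sum i : i \in I -> M i <= K.
Proof.
by move=> iI; rewrite /K (big_fsetD1 i)//= lerDl sumr_ge0.
Qed.

Lemma minimizer_ineq (d a : R) (yd : Y) (x : ell2 R) :
  `|A xdag - yd| <= d -> 0 < a ->
  argmin (Phi A Reg q yd a) x ->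
  Omega Reg x \is a fin_num /\
  `|A x - yd| `^ q <= d `^ q + q * a * (om xdag - om x).
Proof.
move=> Ad a0 /(_ xdag); have q0 : 0 < q := lt_trans ltr01 q_gt1.
have d0 : 0 <= d by exact: le_trans Ad.
rewrite /Phi -(fineK Omega_xdag_fin) -EFinM -EFinD => xmin.
have xfin : Omega Reg x \is a fin_num.
  rewrite ge0_fin_numE ?Omega_ge0// ltNge leye_eq; apply/negP => /eqP xoo.
  by move: xmin; rewrite xoo gt0_muley ?lte_fin// addey// leye_eq.
split=> //; move: xmin.
rewrite -(fineK xfin) -EFinM -EFinD lee_fin => xmin.
have Adq : `|A xdag - yd| `^ q <= d `^ q by rewrite ge0_ler_powR ?nnegrE// ltW.
have : q * (q^-1 * `|A x - yd| `^ q + a * om x) <=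
    q * (q^-1 * `|A xdag - yd| `^ q + a * om xdag) by rewrite ler_pM2l.
by rewrite !mulrDr !mulrA !divff ?gt_eqF// !mul1r; lra.
Qed.

Lemma data_error_le (d : R) (yd : Y) (x : ell2 R) : `|A xdag - yd| <= d ->
  `|A (x - xdag)| <= `|A x - yd| + d.
Proof.
move=> Ad; rewrite linearB -(subrKA yd) (le_trans (ler_normD _ _))// lerD2l.
by rewrite distrC.
Qed.

(** The i-th coordinate of x can vanish only if |xdag_i| <= M_i |A (x - xdag)|,
    and the minimum of |xdag_i| over the finite support is positive. *)
Lemma supp_stable : exists2 eta : R, 0 < eta &
  forall x : ell2 R, `|A (x - xdag)| < eta -> supp xdag `<=` supp x.
Proof.
pose m := \big[Order.min/1]_(i <- I) `|(xdag i : R)|.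
have m0 : 0 < m.
  (* The default value 1 of the minimum is positive as well. *)
  rewrite /m big_seq; apply: lt_bigmin => // i.
  by rewrite mem_supp_xdag normr_gt0.
have K1 : 0 < K + 1 by rewrite ltr_wpDl ?sum_M_ge0.
exists (m / (K + 1)); first by rewrite divr_gt0.
move=> x; rewrite ltr_pdivlMr// => xm i ix; apply/eqP => xi0.
have iI : i \in I by rewrite mem_supp_xdag.
have := coord_le i (x - xdag).
have -> : (x - xdag) i = - (xdag i : R) by rewrite ell2_valB xi0 sub0r.
rewrite normrN; apply/negP; rewrite -ltNge.
have : m <= `|(xdag i : R)| by exact: ge_bigmin_seq.
have := ler_wpM2r (normr_ge0 (A (x - xdag))) (M_le_sum iI).
by have := normr_ge0 (A (x - xdag)); nra.
Qed.

(** A component of x off supp xdag raises the count of nonzero components by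
    one, while Reg can drop by at most W |A (x - xdag)|. *)
Lemma supp_eq (x : ell2 R) : supp xdag `<=` supp x -> Omega Reg x \is a fin_num ->
  om x + W * `|A (x - xdag)| < om xdag + 1 -> supp x `<=` supp xdag.
Proof.
move=> sx xfin h j xj; apply: contrapT => nxj.
have := @ell0_normD1_le R xdag x j sx (conj xj nxj).
have := Reg_source x; move: h xfin; rewrite fin_numD => + /andP[].
rewrite /Omega.
have := Reg_xdag_fin; have := ell0_norm_fin xdag_ell0.
move: (ell0_norm xdag) (ell0_norm x) (Reg xdag) (Reg x).
move=> [n||]// [n'||]// [r||]// [r'||]// _ _ h _ _.
by rewrite -!EFinD !lee_fin /= in h *; lra.
Qed.

(** Once x has at least as many nonzero components as xdag, only Reg can make
    the penalty of x the smaller one, and the source condition controls it. *)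
Lemma om_source (x : ell2 R) :
  supp xdag `<=` supp x -> Omega Reg x \is a fin_num ->
  om xdag - om x <= W * `|A (x - xdag)|.
Proof.
move=> sx; have := ell0_norm_le sx; have := Reg_source x.
rewrite fin_numD => + + /andP[].
rewrite /Omega.
have := Reg_xdag_fin; have := ell0_norm_fin xdag_ell0.
move: (ell0_norm xdag) (ell0_norm x) (Reg xdag) (Reg x).
move=> [n||]// [n'||]// [r||]// [r'||]// _ _.
by rewrite -!EFinD !lee_fin /=; lra.
Qed.

Lemma ell1_error_le (x : ell2 R) : supp x `<=` supp xdag ->
  (ell1_norm (x - xdag)%R <= (K * `|A (x - xdag)|)%:E)%E.
Proof.
move=> sx; rewrite /ell1_norm (@eseries_fin_supp _ I).
- rewrite sumEFin lee_fin /K mulr_suml; apply: ler_sum => i _.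
  exact: (coord_le i (x - xdag)).
- by move=> i; rewrite lee_fin.
- move=> i; rewrite mem_supp_xdag => xi.
  have zi : x i = 0 by apply/eqP; apply: contraNT xi => /sx.
  have zi' : xdag i = 0 by apply/eqP; rewrite -[_ == _]negbK.
  by rewrite ell2_valB zi zi' subr0 normr0.
Qed.

(** The criterion shared by both parameter choices.  The inequality
    d^q <= C d a expresses d^q / a = O(d): the excess of the penalty of the
    minimizer over that of xdag is O(d), hence below 1 for small d. *)
Lemma ell1_rate (L C : R) : exists B : R, \forall d \near 0^'+,
  forall (yd : Y) (a : R) (x : ell2 R), `|A xdag - yd| <= d -> 0 < a ->
    argmin (Phi A Reg q yd a) x ->
    `|A (x - xdag)| <= L * d -> d `^ q <= C * d * a ->
    (ell1_norm (x - xdag)%R <= (B * d)%:E)%E.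
Proof.
have [eta eta0 stab] := supp_stable.
have L1 : 0 < `|L| + 1 by rewrite ltr_wpDl.
have CL1 : 0 < `|C| + W * `|L| + 1 by rewrite ltr_wpDl// addr_ge0// mulr_ge0.
exists (K * L); near=> d => yd a x Ad a0 xmin xL dC.
have d0 : 0 < d by near: d; exact: nbhs_right_gt.
have Leta : (`|L| + 1) * d < eta.
  by rewrite mulrC -ltr_pdivlMr//; near: d; apply: nbhs_right_lt; rewrite divr_gt0.
have small : (`|C| + W * `|L| + 1) * d < 1.
  by rewrite mulrC -ltr_pdivlMr//; near: d; apply: nbhs_right_lt; rewrite divr_gt0.
have nL := ler_norm L; have nC := ler_norm C.
have L0 := normr_ge0 L; have C0 := normr_ge0 C.
have sx : supp xdag `<=` supp x by apply: stab; nra.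
have q1 := q_gt1.
have [xfin ineq] := minimizer_ineq Ad a0 xmin.
(* This is the minimality inequality with its nonnegative left-hand side
   dropped; the factor 1 / q is bounded by 1. *)
have omx : om x - om xdag <= `|C| * d.
  have := powR_ge0 `|A x - yd| q; move: ineq dC.
  move: (d `^ q) (`|A x - yd| `^ q) => P Q ineq dC Q0.
  have : q * a * (om x - om xdag) <= q * a * (`|C| * d).
    have : 0 <= (q - 1) * (`|C| * d * a) by rewrite !mulr_ge0 ?subr_ge0// ltW.
    have : C * d * a <= `|C| * d * a by rewrite !ler_pM2r.
    by lra.
  by rewrite ler_pM2l// mulr_gt0//; lra.
have WL : W * `|A (x - xdag)| <= W * `|L| * d.
  by rewrite -mulrA ler_wpM2l// (le_trans xL)// ler_wpM2r// ltW.
have sx' : supp x `<=` supp xdag by apply: supp_eq => //; nra.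
apply: le_trans (ell1_error_le sx') _.
by rewrite lee_fin -mulrA ler_wpM2l// sum_M_ge0.
Unshelve. all: by end_near. Qed.

(** The rate of the residual is obtained in two passes.  The crude bound
    Omega xdag - Omega x <= Omega xdag shows that the residual tends to 0; only
    then is supp xdag contained in supp x, so that the sharper bound
    Omega xdag - Omega x <= W (T + d) becomes available. *)
Lemma residual_rate (c : R) : 0 <= c -> exists B : R, \forall d \near 0^'+,
  forall (yd : Y) (a : R) (x : ell2 R),
    `|A xdag - yd| <= d -> 0 < a -> a <= c * d `^ (q - 1) ->
    argmin (Phi A Reg q yd a) x ->
    `|A x - yd| <= B * d /\ om xdag - om x <= B * d.
Proof.
move=> c0; have [eta eta0 stab] := supp_stable.
have q0 : 0 < q := lt_trans ltr01 q_gt1.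
have q10 : 0 < q - 1 by rewrite subr_gt0.
pose S := 1 + q * c * om xdag.
have S0 : 0 < S by rewrite ltr_wpDr// !mulr_ge0 ?om_ge0// ltW.
have e0 : 0 < (eta / 2) `^ q / S by rewrite divr_gt0// powR_gt0// divr_gt0.
pose b := (1 + 2 * (q * c * W)) `^ (q - 1)^-1.
exists (b + W * (b + 1)); near=> d => yd a x Ad a0 ac xmin.
have d0 : 0 < d by near: d; exact: nbhs_right_gt.
have d1 : d < 1 by near: d; exact: nbhs_right_lt.
have deta : d < eta / 2 by near: d; apply: nbhs_right_lt; rewrite divr_gt0.
have dS : d `^ (q - 1) < (eta / 2) `^ q / S.
  near: d; exact: (cvgr_lt _ (powR_cvg0 q10)).
have b0 : 0 <= b by exact: powR_ge0.
have [xfin ineq] := minimizer_ineq Ad a0 xmin.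
set T := `|A x - yd| in ineq *.
have T0 : 0 <= T by exact: normr_ge0.
have AT : `|A (x - xdag)| <= T + d := data_error_le x Ad.
have p0 : 0 <= d `^ (q - 1) by exact: powR_ge0.
have pq : d `^ q = d * d `^ (q - 1) by rewrite mulr_powRB1// ltW.
(* First pass: T and d are each below eta / 2. *)
have Teta : T < eta / 2.
  rewrite ltNge; apply/negP => eT.
  have : (eta / 2) `^ q <= T `^ q.
    by rewrite ge0_ler_powR ?nnegrE ?divr_ge0// ltW.
  apply/negP; rewrite -ltNge (le_lt_trans ineq)//.
  move: dS; rewrite ltr_pdivlMr// => /(le_lt_trans _); apply.
  have : q * a * (om xdag - om x) <= q * c * d `^ (q - 1) * om xdag.
    have qac : q * a <= q * c * d `^ (q - 1) by rewrite -mulrA ler_pM2l.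
    apply: le_trans (ler_wpM2r (om_ge0 xdag) qac).
    by rewrite ler_pM2l ?mulr_gt0// lerBlDr lerDl om_ge0.
  have : d * d `^ (q - 1) <= d `^ (q - 1) by rewrite ler_piMl// ltW.
  by rewrite pq /S; lra.
have sx : supp xdag `<=` supp x by apply: stab; lra.
(* Second pass, with the penalty gap bounded by W (T + d). *)
have omW : om xdag - om x <= W * (T + d).
  by apply: le_trans (om_source sx xfin) _; rewrite ler_wpM2l.
have Tb : T <= b * d.
  apply: powR_absorb => //; first by rewrite !mulr_ge0// ltW.
  apply: (le_trans ineq); rewrite lerD2l.
  have -> : q * c * W * d `^ (q - 1) * (T + d) =
      q * (c * d `^ (q - 1)) * (W * (T + d)) by ring.
  apply: (@le_trans _ _ (q * a * (W * (T + d)))).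
    by rewrite ler_wpM2l// mulr_ge0// ltW.
  by rewrite ler_wpM2r ?ler_wpM2l ?mulr_ge0 ?addr_ge0// ltW.
have Wb : W * (T + d) <= W * (b + 1) * d.
  by rewrite -mulrA ler_wpM2l// mulrDl mul1r lerD2r.
split; last by rewrite (le_trans omW)// (le_trans Wb)// mulrDl lerDr mulr_ge0// ltW.
by rewrite (le_trans Tb)// mulrDl lerDl !mulr_ge0 ?addr_ge0// ltW.
Unshelve. all: by end_near. Qed.

(** The overshoot tau d < |A x - yd| excludes very small parameters: when
    b <= d^(q-1), the penalty gap is O(d) and must pay for the surplus
    (tau^q - 1) d^q of the residual; larger b satisfy d^q < d b. *)
Lemma discrepancy_lower_bound (tau : R) : 1 < tau ->
  exists E : R, \forall d \near 0^'+,
  forall (yd : Y) (b : R) (x : ell2 R), `|A xdag - yd| <= d -> 0 < b ->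
    argmin (Phi A Reg q yd b) x -> tau * d < `|A x - yd| ->
    d `^ q <= E * d * b.
Proof.
move=> tau1; have [B resB] := residual_rate ler01.
have q0 : 0 < q := lt_trans ltr01 q_gt1.
pose S := tau `^ q - 1.
have S0 : 0 < S.
  have := gt0_ltr_powR q0 _ _ tau1; rewrite powR1 !nnegrE subr_gt0.
  by apply; lra.
(* The two summands of E serve the two cases b <= d^(q-1) and b > d^(q-1). *)
pose E := q * `|B| / S + 1.
exists E; apply: filterS2 (nbhs_right_gt 0) resB => d d0 resd yd b x Ad b0 xmin xb.
have [bs|bl] := leP b (1 * d `^ (q - 1)); last first.
  rewrite -mulr_powRB1 ?(ltW d0)// mulrAC mulrC ler_pM2r//.
  have : 0 <= q * `|B| / S by rewrite divr_ge0 ?mulr_ge0// ltW.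
  by rewrite mul1r in bl; rewrite /E; nra.
have [_ omB] := resd _ _ _ Ad b0 bs xmin.
have [_ ineq] := minimizer_ineq Ad b0 xmin.
have : (tau * d) `^ q <= `|A x - yd| `^ q.
  have td0 : 0 <= tau * d by rewrite mulr_ge0//; lra.
  by apply: ge0_ler_powR; rewrite ?nnegrE// ltW.
rewrite powRM ?(ltW d0)//; last lra.
move=> /le_trans/(_ ineq) h.
have {}h : S * d `^ q <= q * `|B| * (d * b).
  have : q * b * (om xdag - om x) <= q * b * (`|B| * d).
    apply: ler_wpM2l; first by rewrite ltW// mulr_gt0.
    by apply: le_trans omB _; rewrite ler_pM2r// ler_norm.
  by rewrite /S; lra.
have db : 0 < d * b by exact: mulr_gt0.
rewrite -mulrA /E mulrDl mul1r; apply: ler_wpDr; first exact: ltW.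
by rewrite mulrAC ler_pdivlMr// mulrC.
Qed.

End Tikhonov.

(** * Source conditions *)

Lemma coord_le_adjoint (R : realType) (Y : normedModType R)
    (A : ell2 R -> Y) (Astar : topdual Y -> ell2 R) :
  is_adjoint A Astar ->
  (forall i, exists omega : topdual Y, unit_seq R i = Astar omega) ->
  exists M : nat -> R, (forall i, 0 <= M i) /\
    (forall i (x : ell2 R), `|(x i : R)| <= M i * `|A x|).
Proof.
move=> adj unitA; suff /choice[M HM] : forall i, exists M : R,
    0 <= M /\ forall x : ell2 R, `|(x i : R)| <= M * `|A x|.
  by exists M; split=> i; [exact: (HM i).1|exact: (HM i).2].
move=> i; have [omega omegaE] := unitA i.
have [M M0 wM] := topdual_bound omega; exists M; split=> // x.
by rewrite -(dot_unit_seq x i) omegaE adj.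
Qed.

(** With a subgradient in the range of the adjoint, the subgradient inequality
    reads Reg xdag + w (A (x - xdag)) <= Reg x. *)
Lemma subdifferential_source (R : realType) (Y : normedModType R)
    (A : ell2 R -> Y) (Astar : topdual Y -> ell2 R) (w : topdual Y)
    (Reg : ell2 R -> \bar R) (xdag : ell2 R) :
  is_adjoint A Astar -> (forall x, (0 <= Reg x)%E) -> edom Reg xdag ->
  subdifferential Reg xdag (Astar w) ->
  exists2 W : R, 0 <= W &
    forall x, (Reg xdag <= Reg x + (W * `|A (x - xdag)|)%:E)%E.
Proof.
move=> adj Reg_ge0 xdag_dom xi_sub; have [W W_ge0 wW] := topdual_bound w.
exists W => // x; have := xi_sub x; rewrite adj.
have := wW (A (x - xdag)); rewrite ler_norml => /andP[wl _].
have := Reg_xdag_fin Reg_ge0 xdag_dom; have := Reg_ge0 x.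
case: (Reg xdag) (Reg x) => [r||]// [r'||]// _ _.
  by rewrite -!EFinD !lee_fin; lra.
by move=> _; rewrite addye// leey.
Qed.

(** * Convergence rates *)

Theorem theorem1 (R : realType) (Y : completeNormedModType R)
  (A : {linear ell2 R -> Y}) (Astar : topdual Y -> ell2 R)
  (y : Y) (xdag : ell2 R) (Reg : ell2 R -> \bar R) (q : R)
  (Y_infdim : ~ finite_dimensional Y)
  (A_inj : injective A)
  (A_bounded : bounded_op A)
  (A_adjoint : is_adjoint A Astar)
  (A_range : ~ closed (range A))
  (xdag_sol : A xdag = y)
  (xdag_ell0 : finite_set (supp xdag))
  (xdag_supp : supp xdag !=set0)
  (Reg_ge0 : forall x, (0 <= Reg x)%E)
  (Reg_proper : eproper Reg)
  (Reg_convex : econvex Reg)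
  (Reg_lsc : lower_semicontinuous Reg)
  (Reg_stab : stabilizing Reg)
  (A_unit : forall i : nat, exists omega : topdual Y, unit_seq R i = Astar omega)
  (xdag_dom : edom Reg xdag)
  (xdag_subdiff : subdifferential Reg xdag !=set0)
  (xdag_source : exists (xi : ell2 R) (w : topdual Y),
     subdifferential Reg xdag xi /\ xi = Astar w)
  (q_gt1 : 1 < q) :
  (* a priori choice *)
  (forall alpha : R -> R,
     (forall d, 0 < d -> 0 < alpha d) ->
     (alpha : R -> R^o) \is 'Theta_(0^'+) (fun d : R => d `^ (q - 1) : R^o) ->
     exists C : R, \forall d \near 0^'+,
       forall (yd : Y) (x : R -> ell2 R),
         `|y - yd| <= d -> minimizers A Reg q yd x ->
         (ell1_norm (x (alpha d) - xdag)%R <= (C * d)%:E)%E)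
  /\
  (* sequential discrepancy principle *)
  (forall nu tau alpha0 : R,
     0 < nu < 1 -> 1 < tau -> 0 < alpha0 ->
     exists C : R, \forall d \near 0^'+,
       forall (yd : Y) (x : R -> ell2 R) (alpha : R),
         `|y - yd| <= d -> minimizers A Reg q yd x ->
         discrepancy_choice A nu tau alpha0 d yd x alpha ->
         (ell1_norm (x alpha - xdag)%R <= (C * d)%:E)%E).
Proof.
have [M [M_ge0 coord_le]] := coord_le_adjoint A_adjoint A_unit.
have [xi [w [xi_sub xiE]]] := xdag_source; rewrite xiE in xi_sub.
have [W W_ge0 Reg_source] :=
  subdifferential_source A_adjoint Reg_ge0 xdag_dom xi_sub.
have res := residual_rate q_gt1 xdag_ell0 Reg_ge0 xdag_dom M_ge0 coord_le W_ge0
  Reg_source.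
have rate := ell1_rate q_gt1 xdag_ell0 Reg_ge0 xdag_dom M_ge0 coord_le W_ge0
  Reg_source.
rewrite -xdag_sol; split.
- move=> alpha alpha_gt0.
  rewrite qualifE => /asboolP[[k1 k2] /= /andP[k10 k20] al].
  have [B resB] := res k2 (ltW k20).
  have [C rateC] := rate (B + 1) k1^-1.
  exists C; apply: filterS3 (filterI (nbhs_right_gt 0) al) resB rateC.
  move=> d [d0 ald] resd rated yd x yyd xmin.
  have a0 := alpha_gt0 _ d0.
  have [al1 al2] : k1 * d `^ (q - 1) <= alpha d /\ alpha d <= k2 * d `^ (q - 1).
    by move: ald; rewrite !ger0_norm ?powR_ge0// ltW.
  have [xB _] := resd _ _ _ yyd a0 al2 (xmin _ a0).
  have xL : `|A (x (alpha d) - xdag)| <= (B + 1) * d.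
    by rewrite (le_trans (data_error_le _ yyd))// mulrDl mul1r lerD2r.
  have dq : d `^ q <= k1^-1 * d * alpha d.
    rewrite -mulr_powRB1 ?(ltW d0)//; last exact: lt_trans q_gt1.
    by rewrite mulrAC [leRHS]mulrC ler_pM2l// ler_pdivlMl.
  exact: rated yyd a0 (xmin _ a0) xL dq.
- move=> nu tau alpha0 /andP[nu0 _] tau1 al0.
  have [E lowE] := discrepancy_lower_bound q_gt1 xdag_ell0 Reg_ge0 xdag_dom
    M_ge0 coord_le W_ge0 Reg_source tau1.
  have [C rateC] := rate (tau + 1) (E / nu).
  exists C; apply: filterS3 (nbhs_right_gt 0) lowE rateC => d d0 lowd rated.
  move=> yd x a yyd xmin [j [aE xa xb]].
  (* The lower bound holds at the preceding parameter b = a / nu, where the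
     residual still exceeds tau * d. *)
  pose b := nu ^+ j * alpha0.
  have b0 : 0 < b by rewrite mulr_gt0// exprn_gt0.
  have a0 : 0 < a by rewrite aE mulr_gt0// exprn_gt0.
  have abE : a = nu * b by rewrite aE exprS mulrA.
  have xL : `|A (x a - xdag)| <= (tau + 1) * d.
    by rewrite (le_trans (data_error_le _ yyd))// mulrDl mul1r lerD2r.
  have aq : d `^ q <= E / nu * d * a.
    have -> : E / nu * d * a = E * d * b by rewrite abE; field; rewrite gt_eqF.
    exact: lowd yyd b0 (xmin _ b0) xb.
  exact: rated yyd a0 (xmin _ a0) xL aq.
Qed.
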